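(* Let $\bar d=(d_i)_{i\in\mathbb N}$ be a bounded sequence of integers with $d_i\ge5$ for all $i$. If $H<H_{\bar d}^{alt}$ is a finite saturated subgroup, then the alternate directed group $G(\mathcal A_{d_0},H)=\langle \mathcal A_{d_0}\cup H\rangle<Aut(T_{\bar d})$ has property $\mathcal{DP}$.
   Context: $\mathcal A_d$ is the alternating group on $\{1,\dots,d\}$, $S_d$ the symmetric group. For a sequence $\bar d=(d_i)_{i\ge0}$ of integers $\ge2$, $T_{\bar d}$ is the spherically homogeneous rooted tree whose level-$(k+1)$ vertices are words $t_0t_1\dots t_k$ with $t_i\in\{1,\dots,d_i\}$; $s\bar d=(d_i)_{i\ge1}$ is the shifted sequence. Permutational wreath product: if a group $A$ acts on $\{1,\dots,d\}$, then $G\wr A=(G\times\dots\times G)\rtimes A$ ($d$ factors), with elements $(g_1,\dots,g_d)\sigma$ and product $(g_t)\sigma\cdot(g'_t)\sigma'=(g_1g'_{\sigma(1)},\dots,g_dg'_{\sigma(d)})\sigma\sigma'$, permutations being composed from left to right, $(\sigma\sigma')(t)=\sigma'(\sigma(t))$. There is a canonical isomorphism $Aut(T_{\bar d})\simeq Aut(T_{s\bar d})\wr S_{d_0}$, by which $g=(g_1,\dots,g_{d_0})\sigma$ ($\sigma$ is the permutation induced on the first level, $g_t$ the automorphism induced from the subtree at $t$ to that at $\sigma(t)$; $g$ is applied before $g'$ in $gg'$). Set $AT(d,d')=\mathcal A_{d'}\wr\mathcal A_{d-1}=(\mathcal A_{d'}\times\dots\times\mathcal A_{d'})\rtimes\mathcal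 A_{d-1}$, with $d-1$ factors indexed by $\{2,\dots,d\}$, where $\mathcal A_{d-1}$ is identified with the stabilizer of $1$ in $\mathcal A_{d}$ and permutes the factors. Put $AT_i=AT(d_i,d_{i+1})$ and $H_{\bar d}^{alt}=\prod_{i=0}^\infty AT_i$, with elements $h=(h_i)_{i\ge0}$, $h_i=(a_{i,2},\dots,a_{i,d_i})\rho_i$. This group acts faithfully on $T_{\bar d}$ by the recursive rule $(h_i)_{i=k}^\infty=((h_i)_{i=k+1}^\infty,a_{k,2},\dots,a_{k,d_k})\rho_k$ for all $k\ge0$, where $(h_i)_{i=k}^\infty$ acts on $T_{s^k\bar d}$ and each $a_{k,t}\in\mathcal A_{d_{k+1}}$ acts as a rooted automorphism. A permutation $a\in\mathcal A_{d_0}$ acts on $T_{\bar d}$ as the rooted automorphism $(e,\dots,e)a$. Saturation: let $\bar d$ be bounded and let $H=\langle B\rangle<H_{\bar d}^{alt}$ with $B$ finite, elements of $B$ being written $\beta=(\beta_i)_{i\ge0}$. The pairs $(AT_i,\{\beta_i\}_{\beta\in B})$ (a finite group with a $B$-indexed family of elements) take only finitely many distinct values as $i$ varies; let $J$ be the finite set indexing the distinct values, denoted $(AT(s),\{\beta(s)\}_{\beta\in B})$, $s\in J$. Then $\beta\mapsto(\beta(s))_{s\in J}$ extends to an isomorphism of $H$ onto the subgroup $\langle(\beta(s))_{s\in J}:\beta\in B\rangle$ of $\prod_{s\in J}AT(s)$. $H$ is called saturated if this subgroup is all of $\prod_{s\in J}AT(s)$. Property $\mathcal{DP}$: a sequence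 of groups $(\Gamma_i)_{i\in\mathbb N}$ has property $\mathcal{DP}$ if for all $i\in\mathbb N$: (1) $\Gamma_i$ contains two subgroups $A_i$ and $H_i$ such that (a) $A_i\cup H_i$ generates $\Gamma_i$; (b) $A_i$ is finite and acts transitively on a finite set $\{1,\dots,d_i\}$ of size $d_i\ge 2$; (c) $H_i$ is finitely generated; (2) there is an isomorphism $\varphi_i:\Gamma_i\to\Gamma_{i+1}\wr A_i$ (with $d_i$ factors permuted by $A_i$) such that (a) for every $s\in A_i$, $\varphi_i(s)=(e,\dots,e)s$; (b) for every $h_i\in H_i$ there exist $h_{i+1}\in H_{i+1}$, $a_2,\dots,a_{d_i}\in A_{i+1}$ and $\rho\in A_i$ with $\rho(1)=1$ such that $\varphi_i(h_i)=(h_{i+1},a_2,\dots,a_{d_i})\rho$. A group $\Gamma$ has property $\mathcal{DP}$ if there is a sequence $(\Gamma_i)_{i\in\mathbb N}$ with property $\mathcal{DP}$ such that $\Gamma\simeq\Gamma_0$. *)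

(* Defs.v *)
From HB Require Import structures.
From mathcomp Require Import all_boot all_order all_fingroup all_solvable.
From mathcomp Require Import boolp classical_sets functions cardinality.

Set Implicit Arguments.
Unset Strict Implicit.
Unset Printing Implicit Defensive.

Local Open Scope classical_set_scope.
Local Open Scope group_scope.

(* Groups are [groupType]s, subgroups of [G] are [groupClosed G]s.
   The letters {1, ..., d} are encoded as 'I_d = {0, ..., d - 1}: the
   distinguished letter 1 is the ordinal of value 0, and {2, ..., d} consists
   of the ordinals of nonzero value. *)

Section Generated.
Variables (G : groupType) (B : set G).

Definition gen_subgroup : {pred G} := fun x =>
  `[< forall S : {pred G}, group_closed S -> (forall b, B b -> b \in S) ->
      x \in S >].

Lemma gen_subgroup1 : 1 \in gen_subgroup.
Proof. by apply/asboolP => S [S1 _] _. Qed.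

Lemma gen_subgroupV : invg_closed gen_subgroup.
Proof.
move=> x /asboolP xB; apply/asboolP => S SG SB.
exact/(group_closedV SG)/xB.
Qed.

Lemma gen_subgroupM : mulg_closed gen_subgroup.
Proof.
move=> x y /asboolP xB /asboolP yB; apply/asboolP => S SG SB.
by apply: (group_closedM SG); [apply: xB | apply: yB].
Qed.

HB.instance Definition _ := isMulClosed.Build G gen_subgroup gen_subgroupM.
HB.instance Definition _ := isMul1Closed.Build G gen_subgroup gen_subgroup1.
HB.instance Definition _ := isInvClosed.Build G gen_subgroup gen_subgroupV.

End Generated.

Definition fin_generated (G : groupType) (S : {pred G}) : Prop :=
  exists2 B : set G, finite_set B & S =i gen_subgroup B.

Definition isomorphic_groups (G H : groupType) : Prop :=
  exists f : {multiplicative G -> H}, bijective f.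

Section SubgroupType.
Variables (G : groupType) (S : groupClosed G).

Definition subgroup_type : Type := {x : G | x \in S}.

HB.instance Definition _ := SubChoice.on subgroup_type.

Lemma subgroup_type_closed : group_closed S.
Proof. by split=> [|x y xS yS]; [exact: gpred1 | rewrite gpredM ?gpredV]. Qed.

HB.instance Definition _ :=
  SubChoice_isSubGroup.Build G (mem S) subgroup_type subgroup_type_closed.

End SubgroupType.

Section ProductGroup.
Variables (I : Type) (G : I -> groupType).

Definition prod_group : Type := forall i, G i.

HB.instance Definition _ := Choice.on prod_group.

Definition prod_group_one : prod_group := fun=> 1.
Definition prod_group_inv (x : prod_group) : prod_group := fun i => (x i)^-1.
Definition prod_group_mul (x y : prod_group) : prod_group :=
  fun i => x i * y i.

Lemma prod_group_mulA : associative prod_group_mul.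
Proof. by move=> x y z; apply: functional_extensionality_dep=> i; apply: mulgA. Qed.
Lemma prod_group_mul1 : left_id prod_group_one prod_group_mul.
Proof. by move=> x; apply: functional_extensionality_dep=> i; apply: mul1g. Qed.
Lemma prod_group_mulr1 : right_id prod_group_one prod_group_mul.
Proof. by move=> x; apply: functional_extensionality_dep=> i; apply: mulg1. Qed.
Lemma prod_group_mulV : left_inverse prod_group_one prod_group_inv prod_group_mul.
Proof. by move=> x; apply: functional_extensionality_dep=> i; apply: mulVg. Qed.
Lemma prod_group_mulrV :
  right_inverse prod_group_one prod_group_inv prod_group_mul.
Proof. by move=> x; apply: functional_extensionality_dep=> i; apply: mulgV. Qed.

HB.instance Definition _ := isGroup.Build prod_group
  prod_group_mulA prod_group_mul1 prod_group_mulr1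
  prod_group_mulV prod_group_mulrV.

End ProductGroup.

(* Right actions, as permutations are composed from left to right. *)
Record gaction (A : groupType) (I : Type) := GAction {
  gact :> I -> A -> I;
  gact1 : forall i, gact i 1 = i;
  gactM : forall i a b, gact i (a * b) = gact (gact i a) b
}.

Record wreath (G A : groupType) (I : finType) (to : gaction A I) : Type :=
  Wreath { wbase : {ffun I -> G}; wtop : A }.

Section Wreath.
Variables (G A : groupType) (I : finType) (to : gaction A I).

Definition wreath_pair (x : wreath G to) := (wbase x, wtop x).
Definition pair_wreath (p : {ffun I -> G} * A) : wreath G to :=
  Wreath to p.1 p.2.
Lemma wreath_pairK : cancel wreath_pair pair_wreath.
Proof. by case. Qed.

HB.instance Definition _ := Choice.copy (wreath G to) (can_type wreath_pairK).

Definition wreath_one : wreath G to := Wreath to [ffun=> 1] 1.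
Definition wreath_mul (x y : wreath G to) : wreath G to :=
  Wreath to [ffun t => wbase x t * wbase y (to t (wtop x))] (wtop x * wtop y).
Definition wreath_inv (x : wreath G to) : wreath G to :=
  Wreath to [ffun t => (wbase x (to t (wtop x)^-1))^-1] (wtop x)^-1.

Lemma wreath_mulA : associative wreath_mul.
Proof.
move=> x y z; congr Wreath; last exact: mulgA.
by apply/ffunP=> t; rewrite !ffunE /= gactM mulgA.
Qed.
Lemma wreath_mul1 : left_id wreath_one wreath_mul.
Proof.
move=> [f a]; congr Wreath; last exact: mul1g.
by apply/ffunP=> t; rewrite !ffunE /= gact1 mul1g.
Qed.
Lemma wreath_mulr1 : right_id wreath_one wreath_mul.
Proof.
move=> [f a]; congr Wreath; last exact: mulg1.
by apply/ffunP=> t; rewrite !ffunE mulg1.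
Qed.
Lemma wreath_mulV : left_inverse wreath_one wreath_inv wreath_mul.
Proof.
move=> [f a]; congr Wreath; last exact: mulVg.
by apply/ffunP=> t; rewrite !ffunE mulVg.
Qed.
Lemma wreath_mulrV : right_inverse wreath_one wreath_inv wreath_mul.
Proof.
move=> [f a]; congr Wreath; last exact: mulgV.
by apply/ffunP=> t; rewrite !ffunE /= -gactM mulgV gact1 mulgV.
Qed.

HB.instance Definition _ := isGroup.Build (wreath G to)
  wreath_mulA wreath_mul1 wreath_mulr1 wreath_mulV wreath_mulrV.

End Wreath.

(* A sequence of groups with property DP.  [d], [A], [H] and [to] are chosen
   for the whole sequence because the condition at [i] also involves
   [A i.+1] and [H i.+1]. *)
Definition DP_sequence (Gam : nat -> groupType) : Prop :=
  exists (d : nat -> nat) (A H : forall i, groupClosed (Gam i))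
    (to : forall i, gaction (subgroup_type (A i)) 'I_(d i)),
  forall i,
    [/\ gen_subgroup ([set` A i] `|` [set` H i]) =i predT,
        finite_set [set` A i],
        (2 <= d i)%N /\ (forall t u, exists a, to i t a = u),
        fin_generated (H i)
      & exists phi : {multiplicative Gam i -> wreath (Gam i.+1) (to i)},
        [/\ bijective phi,
            forall s : subgroup_type (A i),
              phi (val s) = Wreath (to i) [ffun=> 1] s
          & forall h, h \in H i ->
            [/\ forall t : 'I_(d i), val t = 0%N ->
                  wbase (phi h) t \in H i.+1,
                forall t : 'I_(d i), val t <> 0%N ->
                  wbase (phi h) t \in A i.+1
              & forall t : 'I_(d i), val t = 0%N ->
                  to i t (wtop (phi h)) = t]]].

Definition has_DP (G : groupType) : Prop :=
  exists2 Gam : nat -> groupType,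
    DP_sequence Gam & isomorphic_groups G (Gam 0%N).

Definition shift (d : nat -> nat) : nat -> nat := fun i => d i.+1.

(* [child t0 (child t1 ... root)] is the word t0 t1 ... . *)
Inductive vertex (d : nat -> nat) : Type :=
| root : vertex d
| child : 'I_(d 0) -> vertex (shift d) -> vertex d.

Arguments root {d}.
Arguments child {d} t v.

(* Removes the last letter of a nonempty word; the root is sent to itself. *)
Fixpoint parent {d : nat -> nat} (v : vertex d) : vertex d :=
  match v with
  | root => root
  | child t w =>
      match w with
      | root => root
      | child _ _ => child t (parent w)
      end
  end.

(* For [v] other than the root, [parent v] is adjacent to [v]: [f] preserves the
   root and the edges. *)
Definition is_tree_aut (d : nat -> nat) (f : vertex d -> vertex d) : Prop :=
  [/\ bijective f, f root = root & {morph f : v / parent v}].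

Record tree_aut (d : nat -> nat) : Type := TreeAut {
  tree_fun :> vertex d -> vertex d;
  tree_funP : `[< is_tree_aut tree_fun >]
}.

HB.instance Definition _ (d : nat -> nat) := [isSub for @tree_fun d].
HB.instance Definition _ (d : nat -> nat) := gen_eqMixin (tree_aut d).
HB.instance Definition _ (d : nat -> nat) := gen_choiceMixin (tree_aut d).

Section TreeAutGroup.
Variable d : nat -> nat.
Implicit Types f g : tree_aut d.

Lemma tree_autP f g : (forall v, f v = g v) -> f = g.
Proof. by move=> fg; apply: val_inj; apply: functional_extensionality_dep. Qed.

Fact tree_one_subproof : `[< is_tree_aut (@id (vertex d)) >].
Proof. by apply/asboolP; split=> //; exists id. Qed.
Definition tree_one : tree_aut d := TreeAut tree_one_subproof.

Fact tree_mul_subproof f g : `[< is_tree_aut (g \o f) >].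
Proof.
have /asboolP[fb f1 fM] := tree_funP f; have /asboolP[gb g1 gM] := tree_funP g.
apply/asboolP; split; first exact: bij_comp.
- by rewrite /= f1.
- by move=> v /=; rewrite fM gM.
Qed.
(* f * g is f followed by g. *)
Definition tree_mul f g : tree_aut d := TreeAut (tree_mul_subproof f g).

Fact tree_inv_subproof f :
  {g : vertex d -> vertex d | cancel f g /\ cancel g f}.
Proof.
have /asboolP[fb _ _] := tree_funP f.
by apply: cid; case: fb => g fK gK; exists g.
Qed.
Definition tree_inv_fun f := sval (tree_inv_subproof f).

Fact tree_inv_aut f : `[< is_tree_aut (tree_inv_fun f) >].
Proof.
have [fK gK] := svalP (tree_inv_subproof f).
have /asboolP[_ f1 fM] := tree_funP f.
apply/asboolP; split; first by exists f.
- by rewrite -[in LHS]f1 [LHS]fK.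
- by move=> v; apply: (can_inj fK); rewrite fM !gK.
Qed.
Definition tree_inv f : tree_aut d := TreeAut (tree_inv_aut f).

Lemma tree_mulA : associative tree_mul.
Proof. by move=> f g h; apply: tree_autP. Qed.
Lemma tree_mul1 : left_id tree_one tree_mul.
Proof. by move=> f; apply: tree_autP. Qed.
Lemma tree_mulr1 : right_id tree_one tree_mul.
Proof. by move=> f; apply: tree_autP. Qed.
Lemma tree_mulV : left_inverse tree_one tree_inv tree_mul.
Proof.
by move=> f; apply: tree_autP => v; case: (svalP (tree_inv_subproof f)) => _; apply.
Qed.
Lemma tree_mulrV : right_inverse tree_one tree_inv tree_mul.
Proof.
by move=> f; apply: tree_autP => v; case: (svalP (tree_inv_subproof f)) => + _; apply.
Qed.

HB.instance Definition _ := isGroup.Build (tree_aut d)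
  tree_mulA tree_mul1 tree_mulr1 tree_mulV tree_mulrV.

End TreeAutGroup.

Section AltStab.
Variable d : nat.

(* The alternating group A_(d-1), as the stabilizer of the letter 1 in A_d. *)
Definition alt_stab : {group {perm 'I_d}} :=
  'C_('Alt_('I_d))([set t : 'I_d | val t == 0%N] | 'P)%G.

Lemma alt_stab_fix (s : [subg alt_stab]) (t : 'I_d) :
  val t = 0%N -> sgval s t = t.
Proof.
move=> t0; have := subgP s; rewrite inE => /andP[_ /astabP sf].
by apply: sf; rewrite inE t0.
Qed.

(* The letters {2, ..., d}. *)
Definition tail_letter : finType := {t : 'I_d | val t != 0%N}.

Fact alt_stab_act_subproof (t : tail_letter) (s : [subg alt_stab]) :
  val (sgval s (val t)) != 0%N.
Proof.
apply: contra (valP t) => /eqP st0.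
by rewrite -(perm_inj (alt_stab_fix s st0)) st0.
Qed.

Definition alt_stab_act (t : tail_letter) (s : [subg alt_stab]) :
  tail_letter := Sub (sgval s (val t)) (alt_stab_act_subproof t s).

Lemma alt_stab_act1 t : alt_stab_act t 1 = t.
Proof. by apply: val_inj; rewrite /= perm1. Qed.
Lemma alt_stab_actM t a b :
  alt_stab_act t (a * b) = alt_stab_act (alt_stab_act t a) b.
Proof. by apply: val_inj; rewrite /= permM. Qed.

Definition alt_stab_action := GAction alt_stab_act1 alt_stab_actM.

End AltStab.

Definition AT (d d' : nat) : groupType :=
  wreath (subg_of 'Alt_('I_d')) (alt_stab_action d).

Definition H_alt (d : nat -> nat) : groupType :=
  prod_group (fun i => AT (d i) (d i.+1)).

Section Rooted.
Variables (d : nat -> nat).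

Definition rooted_fun (a : {perm 'I_(d 0)}) (v : vertex d) : vertex d :=
  if v is child t w then child (a t) w else root.

Lemma rooted_funM a b v :
  rooted_fun (a * b) v = rooted_fun b (rooted_fun a v).
Proof. by case: v => //= t w; rewrite permM. Qed.
Lemma rooted_fun1 v : rooted_fun 1 v = v.
Proof. by case: v => //= t w; rewrite perm1. Qed.

Fact rooted_subproof a : `[< is_tree_aut (rooted_fun a) >].
Proof.
apply/asboolP; split=> //.
- by exists (rooted_fun a^-1) => v; rewrite -rooted_funM ?mulgV ?mulVg rooted_fun1.
- by case=> //= t [].
Qed.
Definition rooted (a : {perm 'I_(d 0)}) : tree_aut d :=
  TreeAut (rooted_subproof a).

End Rooted.

Definition H_alt_tail (d : nat -> nat) (h : H_alt d) : H_alt (shift d) :=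
  fun i => h i.+1.

(* [insub t] is [None] exactly for the distinguished letter: its subtree is
   acted upon by the tail of [h], that of any other letter [t] by the rooted
   automorphism a_(0,t). *)
Fixpoint directed_fun (d : nat -> nat) (h : H_alt d) (v : vertex d) {struct v} :
    vertex d :=
  match v with
  | root => root
  | child t w =>
      child (sgval (wtop (h 0%N)) t)
        (if insub t is Some u then rooted_fun (sgval (wbase (h 0%N) u)) w
         else directed_fun (H_alt_tail h) w)
  end.

Lemma directed_fun1 d (v : vertex d) : directed_fun 1 v = v.
Proof.
elim: v => //= {}d t w IHw; rewrite perm1; congr child.
by case: insubP => // u _ _; rewrite ffunE rooted_fun1.
Qed.

Lemma directed_funM d (g h : H_alt d) v :
  directed_fun (g * h) v = directed_fun h (directed_fun g v).
Proof.
elim: v g h => //= {}d t w IHw g h; rewrite permM; congr child.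
case: (insubP _ t) => [u _ tu|].
- have -> : insub (sgval (wtop (g 0%N)) t) =
            Some (alt_stab_act u (wtop (g 0%N))) :> option (tail_letter _).
    by rewrite -tu -(valK (alt_stab_act u _)).
  by rewrite ffunE rooted_funM.
- rewrite negbK => /eqP t0.
  rewrite (alt_stab_fix _ t0).
  by rewrite insubF ?t0 // -IHw.
Qed.

Lemma directed_fun_root d (h : H_alt d) : directed_fun h root = root.
Proof. by []. Qed.

Lemma directed_fun_parent d (h : H_alt d) :
  {morph directed_fun h : v / parent v}.
Proof.
move=> v; elim: v h => //= {}d t [|u w] IHw h /=.
  by case: insub.
case: insub => [z|]; last by rewrite -IHw.
by case: w {IHw}.
Qed.

Fact directed_subproof d (h : H_alt d) : `[< is_tree_aut (directed_fun h) >].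
Proof.
apply/asboolP; split=> //; last exact: directed_fun_parent.
by exists (directed_fun h^-1) => v; rewrite -directed_funM ?mulgV ?mulVg directed_fun1.
Qed.
Definition directed d (h : H_alt d) : tree_aut d := TreeAut (directed_subproof h).

Section Saturated.
Variables (d : nat -> nat) (B : set (H_alt d)).

(* Pairs consisting of a finite group AT(p, q), represented by (p, q), and a
   B-indexed family of elements of it. *)
Definition AT_family : Type :=
  {p : nat * nat & {b | B b} -> AT p.1 p.2}.

Definition AT_family_at (i : nat) : AT_family :=
  existT (fun p : nat * nat => {b | B b} -> AT p.1 p.2)
    (d i, d i.+1) (fun b => sval b i).

(* The set J of the distinct values of [AT_family_at]. *)
Definition AT_values : Type := {s : AT_family | range AT_family_at s}.

Definition AT_values_prod : groupType :=
  prod_group (fun s : AT_values => AT (tag (sval s)).1 (tag (sval s)).2).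

Definition AT_values_elt (b : {b | B b}) : AT_values_prod :=
  fun s => tagged (sval s) b.

Definition saturating : Prop :=
  gen_subgroup (range AT_values_elt) =i predT.

End Saturated.

Definition saturated (d : nat -> nat) (H : {pred H_alt d}) : Prop :=
  exists B : set (H_alt d),
    [/\ finite_set B, H =i gen_subgroup B & saturating B].

(* The alternate directed group G(A_(d 0), H). *)
Definition alt_directed_group (d : nat -> nat) (H : groupClosed (H_alt d)) :
    groupClosed (tree_aut d) :=
  gen_subgroup ((@rooted d @` [set` 'Alt_('I_(d 0))]) `|` (@directed d @` [set` H])).

(* Main.v *)
(* Restricting automorphisms to the subtrees of the first level maps
   G(A_{d_0}, H) into the wreath product G(A_{d_1}, H') wr A_{d_0}, where H' is
   the image of H under the shift; only surjectivity is at stake.  Saturation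
   makes every coordinate map H -> AT_i surjective, so H contains elements
   (h', a, e, ..., e) with [a] in A_{d_1} arbitrary.  Conjugating one of them by
   a rooted 3-cycle that fixes 2 and moves 1, its commutator with another one is
   (e, [a, b], e, ..., e); as A_{d_1} is perfect, the image contains A_{d_1} in
   every coordinate.  Dividing (h', a_2, ..., a_d)rho by its rooted parts then
   leaves (h', e, ..., e), so that the image is everything.  The shift H'
   inherits the surjectivity of all coordinate maps, which is the only
   consequence of saturation needed, hence the argument iterates. *)

Require Import Defs.
From HB Require Import structures.
From mathcomp Require Import all_boot all_order all_fingroup all_solvable.
From mathcomp Require Import boolp classical_sets functions cardinality.

Set Implicit Arguments.
Unset Strict Implicit.
Unset Printing Implicit Defensive.

Local Open Scope classical_set_scope.

(** * Alternating groups of degree at least 5 *)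

Section Alternating.
Local Open Scope group_scope.
Variable T : finType.

Lemma exists_notin (s : seq T) : size s < #|T| -> exists x, x \notin s.
Proof.
move=> sT; apply/existsP; apply: contraLR sT; rewrite negb_exists -leqNgt.
move=> /forallP sall; rewrite cardE uniq_leq_size ?enum_uniq // => x _.
by rewrite -[_ \in _]negbK.
Qed.

(** Products are read from left to right, so for distinct letters this is the cycle a -> b -> c ->
    a. *)
Definition cycle3 (a b c : T) : {perm T} := tperm a b * tperm a c.

Lemma cycle3_Alt a b c : a != b -> a != c -> cycle3 a b c \in 'Alt_T.
Proof. by move=> ab ac; rewrite Alt_even odd_permM !odd_tperm ab ac. Qed.

Lemma cycle3_1 a b c : a != b -> b != c -> cycle3 a b c a = b.
Proof. by move=> ab bc; rewrite permM tpermL tpermD // eq_sym. Qed.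

Lemma cycle3_2 a b c : cycle3 a b c b = c.
Proof. by rewrite permM tpermR tpermL. Qed.

Lemma cycle3_fix a b c x : x != a -> x != b -> x != c -> cycle3 a b c x = x.
Proof. by move=> xa xb xc; rewrite permM !tpermD // eq_sym. Qed.

(** By simplicity the derived subgroup is trivial or everything. It is not trivial: the cycles (a b
    c) and (a b e) do not commute, as their product sends a to e in one order and to c in the
    other. *)
Lemma Alt_perfect : 4 < #|T| -> [~: 'Alt_T, 'Alt_T] = 'Alt_T.
Proof.
move=> T5; have /simpleP[_ /(_ _ (der_normal 1 'Alt_T))[]//] := simple_Alt5 T5.
move=> /derG1P /centsP cA; exfalso.
have [|a _] := @exists_notin [::]; first exact: leq_trans T5.
have [|b] := @exists_notin [:: a]; first exact: leq_trans T5.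
rewrite inE eq_sym => ab.
have [|c] := @exists_notin [:: a; b]; first exact: leq_trans T5.
rewrite !inE !(eq_sym c) negb_or => /andP[ac bc].
have [|e] := @exists_notin [:: a; b; c]; first exact: leq_trans T5.
rewrite !inE !(eq_sym e) !negb_or => /and3P[ae be ce].
have /permP/(_ a) := cA _ (cycle3_Alt ab ac) _ (cycle3_Alt ab ae).
rewrite (permM (cycle3 a b c)) (permM (cycle3 a b e)) !cycle3_1 // !cycle3_2.
by move=> /esym/eqP; apply/negP.
Qed.

Lemma Alt_moves (a b : T) : 4 < #|T| -> exists2 s, s \in 'Alt_T & s a = b.
Proof.
move=> T5; have [<-|ab] := eqVneq a b; first by exists 1; rewrite ?perm1.
have [|c] := @exists_notin [:: a; b]; first exact: leq_trans T5.
rewrite !inE !(eq_sym c) negb_or => /andP[ac bc].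
by exists (cycle3 a b c); rewrite ?cycle3_Alt ?cycle3_1.
Qed.

(** A 3-cycle through [a] and two letters other than [b]. It will pull apart the supports of two
    elements at one letter while keeping another letter in place. *)
Lemma Alt_displaces (a b : T) : 4 < #|T| -> a != b ->
  exists2 s, s \in 'Alt_T & s b = b /\ s a != a.
Proof.
move=> T5 ab; have [|c] := @exists_notin [:: a; b]; first exact: leq_trans T5.
rewrite !inE !(eq_sym c) negb_or => /andP[ac bc].
have [|e] := @exists_notin [:: a; b; c]; first exact: leq_trans T5.
rewrite !inE !(eq_sym e) !negb_or => /and3P[ae be ce].
exists (cycle3 a c e); first exact: cycle3_Alt.
by rewrite cycle3_1 // cycle3_fix // eq_sym.
Qed.

End Alternating.

(** * Induction on generated subgroups *)

Section GeneratedSubgroups.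
Local Open Scope group_scope.
Variable G : groupType.

Lemma mem_gen_subgroup (B : set G) b : B b -> b \in gen_subgroup B.
Proof. by move=> Bb; apply/asboolP => S _; apply. Qed.

Lemma gen_subgroup_ind (B : set G) (P : G -> Prop) :
    P 1 -> (forall x y, P x -> P y -> P (x * y^-1)) -> (forall b, B b -> P b) ->
  forall x, x \in gen_subgroup B -> P x.
Proof.
move=> P1 PF PB x /asboolP/(_ [pred y | `[< P y >]])xP.
apply/asboolP/xP; last by move=> b /PB Pb; apply/asboolP.
split; first exact/asboolP.
by move=> y z /asboolP Py /asboolP Pz; apply/asboolP/PF.
Qed.

(** Images and preimages are packaged below as [groupClosed] objects by wrapping them in
    [gen_subgroup]; this recovers plain membership in them. *)
Lemma gen_subgroup_id (B : set G) :
    B 1 -> (forall x y, B x -> B y -> B (x * y^-1)) ->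
  forall x, x \in gen_subgroup B <-> B x.
Proof.
by move=> B1 BF x; split; [exact: gen_subgroup_ind | exact: mem_gen_subgroup].
Qed.

Lemma gen_subgroup_self (H : groupClosed G) : H =i gen_subgroup [set` H].
Proof.
move=> x; apply/idP/idP => [|/gen_subgroup_id]; first exact: mem_gen_subgroup.
by apply=> [|y z]; [exact: gpred1 | exact: gpredF].
Qed.

End GeneratedSubgroups.

(** * Consequences of multiplicativity for bare functions *)

Section Morphisms.
Local Open Scope group_scope.
Variables (G K : groupType) (f : G -> K).
Hypothesis fM : {morph f : x y / x * y}.

Lemma morph_one : f 1 = 1.
Proof. by apply: (@mulgI _ (f 1)); rewrite -fM !mulg1. Qed.

Lemma morph_div : {morph f : x y / x * y^-1}.
Proof. by move=> x y; apply: (@mulIg _ (f y)); rewrite -fM !mulgVK. Qed.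

Lemma morph_commg : {morph f : x y / [~ x, y]}.
Proof.
have fV x : f x^-1 = (f x)^-1 by rewrite -(mul1g x^-1) morph_div morph_one mul1g.
by move=> x y; rewrite /commg /conjg !(fM, fV).
Qed.

Lemma gen_subgroup_image (H : groupClosed G) x :
  x \in gen_subgroup (f @` [set` H]) <-> (f @` [set` H]) x.
Proof.
apply: gen_subgroup_id => [|_ _ [y yH <-] [z zH <-]].
  by exists 1; [exact: gpred1 | exact: morph_one].
by exists (y * z^-1); [exact: gpredF | exact: morph_div].
Qed.

End Morphisms.

(** * Generating a wreath product by rooted and one-coordinate elements *)

Section WreathGeneration.
Local Open Scope group_scope.
Variables (G A : groupType) (I : finType) (to : gaction A I).
Implicit Types (t u : I) (g x y : G) (a : A) (w : wreath G to).

Lemma wreath_eq w1 w2 : wbase w1 =1 wbase w2 -> wtop w1 = wtop w2 -> w1 = w2.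
Proof. by case: w1 w2 => [f a] [g b] /= /ffunP-> ->. Qed.

Lemma wbaseM w1 w2 t :
  wbase (w1 * w2) t = wbase w1 t * wbase w2 (to t (wtop w1)).
Proof. by rewrite ffunE. Qed.

Lemma wtopM w1 w2 : wtop (w1 * w2) = wtop w1 * wtop w2.
Proof. by []. Qed.

Lemma wbase1 t : wbase (1 : wreath G to) t = 1.
Proof. by rewrite ffunE. Qed.

Lemma wbaseV w t : wbase w^-1 t = (wbase w (to t (wtop w)^-1))^-1.
Proof. by rewrite ffunE. Qed.

Lemma wtopV w : wtop w^-1 = (wtop w)^-1.
Proof. by []. Qed.

Lemma wbaseR w1 w2 t : wtop w1 = 1 -> wtop w2 = 1 ->
  wbase [~ w1, w2] t = [~ wbase w1 t, wbase w2 t].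
Proof.
move=> w11 w21; rewrite /commg /conjg !(wbaseM, wbaseV, wtopM, wtopV) w11 w21.
by rewrite !(invg1, mul1g, Defs.gact1).
Qed.

Lemma wtopR w1 w2 : wtop w1 = 1 -> wtop w2 = 1 -> wtop [~ w1, w2] = 1.
Proof.
by move=> w11 w21; rewrite /commg /conjg !(wtopM, wtopV) w11 w21 !(invg1, mul1g).
Qed.

Definition wrooted a : wreath G to := Wreath to [ffun=> 1] a.

Definition wsingle t g : wreath G to :=
  Wreath to [ffun u => if u == t then g else 1] 1.

Lemma wsingleE t g u : wbase (wsingle t g) u = if u == t then g else 1.
Proof. by rewrite ffunE. Qed.

Lemma wsingleM t : {morph wsingle t : x y / x * y}.
Proof.
move=> x y; apply: wreath_eq => [u|]; last by rewrite wtopM mul1g.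
by rewrite wbaseM Defs.gact1 !wsingleE; case: eqP; rewrite ?mul1g.
Qed.

Lemma wrooted_conj w a t :
  wbase (w ^ wrooted a) t = wbase w (to t a^-1).
Proof. by rewrite !(wbaseM, wbaseV, wtopM, wtopV) /= !ffunE invg1 mul1g mulg1. Qed.

(** Conjugation by a rooted element permutes the coordinates; by transitivity of the action,
    controlling a single coordinate will be enough. *)
Lemma wsingleJ t g a : wsingle t g ^ wrooted a = wsingle (to t a) g.
Proof.
apply: wreath_eq => [u|]; last first.
  by rewrite !(wtopM, wtopV) /= mul1g mulVg.
rewrite wrooted_conj !wsingleE; congr (if _ then _ else _).
by apply/eqP/eqP => [<-|->]; rewrite -Defs.gactM ?mulVg ?mulgV Defs.gact1.
Qed.

(** The order of the factors is immaterial, since their supports are disjoint. *)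
Definition wprod (f : I -> G) : wreath G to := \prod_t wsingle t (f t).

Lemma wtop_wprod f : wtop (wprod f) = 1.
Proof. by rewrite /wprod; elim/big_rec: _ => // t w _ w1; rewrite wtopM w1 mulg1. Qed.

Lemma wbase_wprod f t : wbase (wprod f) t = f t.
Proof.
suff H r : uniq r -> wbase (\prod_(u <- r) wsingle u (f u)) t =
    if t \in r then f t else 1.
  by rewrite /wprod (H _ (index_enum_uniq I)) mem_index_enum.
elim: r => [|u r IHr] /=; first by rewrite big_nil wbase1.
case/andP=> ur {}/IHr IHr; rewrite big_cons wbaseM Defs.gact1 IHr wsingleE inE.
by have [->|] := eqVneq t u; rewrite ?(negPf ur) ?mulg1 ?mul1g.
Qed.

Lemma wreathE w : w = wprod (wbase w) * wrooted (wtop w).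
Proof.
apply: wreath_eq => [t|]; last by rewrite wtopM wtop_wprod mul1g.
by rewrite wbaseM wbase_wprod ffunE mulg1.
Qed.

Variable S : groupClosed (wreath G to).
Hypothesis S_rooted : forall a, wrooted a \in S.

Lemma wsingle_transport t u g : (exists a, to t a = u) ->
  wsingle t g \in S -> wsingle u g \in S.
Proof. by case=> a <- tgS; rewrite -wsingleJ gpredJ. Qed.

Lemma wreath_full : (forall t g, wsingle t g \in S) -> S =i predT.
Proof.
move=> Sall w; rewrite [w]wreathE gpredM //.
by apply: gpred_prod => t _; apply: Sall.
Qed.

(** Dividing [w] by its rooted top leaves the product of its coordinates; dividing further by [q],
    the product of those away from [t0], isolates the coordinate at [t0]. *)
Lemma wsingle_strip w t0 : w \in S ->
    (forall t, t != t0 -> wsingle t (wbase w t) \in S) ->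
  wsingle t0 (wbase w t0) \in S.
Proof.
move=> wS wt; pose q := wprod (fun t => if t == t0 then 1 else wbase w t).
have qS : q \in S.
  apply: gpred_prod => t _; case: eqVneq => [_|/wt//].
  by rewrite (morph_one (wsingleM t)) gpred1.
suff -> : wsingle t0 (wbase w t0) = w * (wrooted (wtop w))^-1 * q^-1.
  by rewrite !gpredF.
have -> : w * (wrooted (wtop w))^-1 = wprod (wbase w).
  by rewrite {1}[w]wreathE mulgK.
apply: (@mulIg _ q); rewrite mulgVK.
apply: wreath_eq => [t|]; last by rewrite wtopM !wtop_wprod mulg1.
rewrite wbaseM Defs.gact1 !wbase_wprod wsingleE.
by case: eqVneq => [->|]; rewrite ?mulg1 ?mul1g.
Qed.

(* Conjugating [w2] by a rooted element that fixes [u] and moves [t0] makes the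
   supports of the two elements meet at [u] only. *)
Lemma wsingle_commutator w1 w2 t0 u a : w1 \in S -> w2 \in S ->
    wtop w1 = 1 -> wtop w2 = 1 ->
    (forall t, t != t0 -> t != u -> wbase w1 t = 1) ->
    (forall t, t != t0 -> t != u -> wbase w2 t = 1) ->
    to u a = u -> to t0 a != t0 -> t0 != u ->
  wsingle u [~ wbase w1 u, wbase w2 u] \in S.
Proof.
move=> w1S w2S w11 w21 w1t w2t ua t0a t0u.
suff -> : wsingle u [~ wbase w1 u, wbase w2 u] = [~ w1, w2 ^ wrooted a].
  by rewrite gpredR ?gpredJ.
have w2a1 : wtop (w2 ^ wrooted a) = 1.
  by rewrite !(wtopM, wtopV) w21 mul1g mulVg.
have uaV : to u a^-1 = u by rewrite -{1}ua -Defs.gactM mulgV Defs.gact1.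
apply: wreath_eq => [t|]; last by rewrite wtopR.
rewrite wbaseR // wrooted_conj wsingleE.
case: eqVneq => [->|tu]; first by rewrite uaV.
have [->|tt0] := eqVneq t t0; last by rewrite w1t // comm1g.
(* At [t0] the conjugate reads [w2] at [to t0 a^-1], which differs from [t0] because [a] moves [t0],
   and from [u] because [a] fixes [u]. *)
rewrite [wbase w2 _]w2t ?commg1 //.
  by apply: contra t0a => /eqP {1}<-; rewrite -Defs.gactM mulVg Defs.gact1.
by apply: contra t0u => /eqP t0V; rewrite -[t0](Defs.gact1 to) -(mulVg a) Defs.gactM t0V ua.
Qed.

End WreathGeneration.

Lemma insub_tail n (t : 'I_n) (t0 : val t != 0) :
  insub t = Some (Sub t t0 : tail_letter n).
Proof. exact: insubT. Qed.

(** * First-level permutation and sections of a tree automorphism *)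

Section Sections.
Local Open Scope group_scope.
Variable d : nat -> nat.
Implicit Types (x y : tree_aut d) (v : vertex d) (t u : 'I_(d 0)).
Implicit Type w : vertex (shift d).

Fixpoint depth (e : nat -> nat) (v : vertex e) : nat :=
  if v is child _ w then (depth w).+1 else 0.

(** The default [t] is needed because ['I_(d 0)] may be empty here; it is returned at the root only,
    and the image of a nonempty word is never the root. *)
Definition letter t v : 'I_(d 0) := if v is child u _ then u else t.
Definition subword v : vertex (shift d) :=
  if v is child _ w then w else Defs.root.

Lemma parent_child t w : w <> Defs.root -> parent (child t w) = child t (parent w).
Proof. by case: w. Qed.

Lemma depth_parent (e : nat -> nat) (v : vertex e) :
  depth (parent v) = (depth v).-1.
Proof. by elim: v => //= {}e t [|u w] //= ->. Qed.

Lemma letter_parent t v : parent v <> Defs.root -> letter t (parent v) = letter t v.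
Proof. by case: v => // u [|]. Qed.

Lemma tree_root x : x Defs.root = Defs.root.
Proof. by have /asboolP[] := tree_funP x. Qed.

Lemma tree_parent x v : x (parent v) = parent (x v).
Proof. by have /asboolP[_ _ ->] := tree_funP x. Qed.

Lemma tree_inj x : injective x.
Proof. by have /asboolP[/bij_inj]:= tree_funP x. Qed.

Lemma tree_child_neq x t w : x (child t w) <> Defs.root.
Proof. by rewrite -(tree_root x) => /tree_inj. Qed.

Lemma treeM x y v : (x * y) v = y (x v).
Proof. by []. Qed.

Definition first_letter t x : 'I_(d 0) := letter t (x (child t Defs.root)).

(** An automorphism commutes with [parent], so deleting the last letter of [w] does not change the
    first letter of the image. The induction is on the depth, [parent w] being no structural subterm
    of [w]. *)
Lemma letter_tree x t w : letter t (x (child t w)) = first_letter t x.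
Proof.
move: {2}(depth w) (erefl (depth w)) => n; elim: n => [|n IHn] in w *.
  by case: w.
move=> wn; rewrite -(IHn (parent w)) ?depth_parent ?wn //.
have wr : w <> Defs.root by move=> w0; rewrite w0 in wn.
rewrite -parent_child // tree_parent letter_parent // -tree_parent parent_child //.
exact: tree_child_neq.
Qed.

Definition tree_section_fun x t w : vertex (shift d) := subword (x (child t w)).

Lemma tree_child x t w :
  x (child t w) = child (first_letter t x) (tree_section_fun x t w).
Proof.
rewrite -(letter_tree x t w) /tree_section_fun.
by case: (x (child t w)) (@tree_child_neq x t w).
Qed.

Lemma first_letterM t x y :
  first_letter t (x * y) = first_letter (first_letter t x) y.
Proof. by rewrite {1}/first_letter treeM tree_child tree_child. Qed.

Lemma tree_section_funM x y t w : tree_section_fun (x * y) t w =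
  tree_section_fun y (first_letter t x) (tree_section_fun x t w).
Proof. by rewrite {1}/tree_section_fun treeM tree_child tree_child. Qed.

Lemma tree_section_subproof x t : `[< is_tree_aut (tree_section_fun x t) >].
Proof.
have sr : tree_section_fun x t Defs.root = Defs.root.
  have := tree_parent x (child t Defs.root); rewrite tree_root tree_child.
  by rewrite /tree_section_fun /=; case: (subword _).
have inj : injective (tree_section_fun x t).
  move=> w1 w2 e; have := tree_child x t w1; rewrite e -tree_child.
  by move/tree_inj => [].
apply/asboolP; split=> //.
(* The inverse of the section at [t] is the section of the inverse at the image of [t]. *)
- exists (tree_section_fun x^-1 (first_letter t x)) => w.
    by rewrite -tree_section_funM mulgV.
  have {1}-> : t = first_letter (first_letter t x) x^-1.
    by rewrite -first_letterM mulgV.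
  by rewrite -tree_section_funM mulVg.
- move=> w; have [->|wr] := pselect (w = Defs.root); first by rewrite !sr.
  have := tree_parent x (child t w); rewrite parent_child // !tree_child.
  (* What remains is that the image of [w] is not the root: the section is injective and fixes the
     root. *)
  rewrite parent_child; first by case.
  by rewrite -sr => /inj.
Qed.

Definition tree_section x t : tree_aut (shift d) :=
  TreeAut (tree_section_subproof x t).

Lemma tree_sectionM x y t :
  tree_section (x * y) t = tree_section x t * tree_section y (first_letter t x).
Proof. by apply: tree_autP => w; apply: tree_section_funM. Qed.

(** Multiplicativity applied to [(x * y^-1) * y]; this is why [y] is sectioned at the image of [t]
    under the whole quotient. *)
Lemma tree_sectionF x y t : tree_section (x * y^-1) t =
  tree_section x t * (tree_section y (first_letter t (x * y^-1)))^-1.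
Proof.
apply: (@mulIg _ (tree_section y (first_letter t (x * y^-1)))).
by rewrite -tree_sectionM !mulgVK.
Qed.

Lemma tree_section_eq x y :
    (forall t, first_letter t x = first_letter t y) ->
    (forall t, tree_section x t = tree_section y t) ->
  x = y.
Proof.
move=> l s; apply: tree_autP => -[|t w]; first by rewrite !tree_root.
rewrite !tree_child l; congr child.
by have /(congr1 (fun z => tree_fun z w)) := s t.
Qed.

Lemma first_letter_inj x : injective (first_letter^~ x).
Proof.
by apply: (can_inj (g := first_letter^~ x^-1)) => t; rewrite -first_letterM mulgV.
Qed.

Definition first_perm x : {perm 'I_(d 0)} := perm (first_letter_inj (x := x)).

Lemma first_permE x t : first_perm x t = first_letter t x.
Proof. by rewrite permE. Qed.

Lemma first_permM : {morph first_perm : x y / x * y}.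
Proof. by move=> x y; apply/permP => t; rewrite permM !first_permE first_letterM. Qed.

Lemma rootedM : {morph @rooted d : a b / a * b}.
Proof. by move=> a b; apply: tree_autP => v; apply: rooted_funM. Qed.

Lemma directedM : {morph @directed d : g h / g * h}.
Proof. by move=> g h; apply: tree_autP => v; apply: directed_funM. Qed.

Lemma first_perm_rooted a : first_perm (rooted a) = a.
Proof. by apply/permP => t; rewrite first_permE. Qed.

Lemma tree_section_rooted a t : tree_section (rooted a) t = 1.
Proof. by apply: tree_autP. Qed.

Lemma first_perm_directed (h : H_alt d) :
  first_perm (directed h) = sgval (wtop (h 0)).
Proof. by apply/permP => t; rewrite first_permE. Qed.

Lemma tree_section_directed (h : H_alt d) t : tree_section (directed h) t =
  if insub t is Some u then rooted (d := shift d) (sgval (wbase (h 0) u))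
  else directed (H_alt_tail h).
Proof.
apply: tree_autP => w; rewrite /= /tree_section_fun /=.
by case: insub.
Qed.

Variable H : groupClosed (H_alt d).

Definition tail_group : groupClosed (H_alt (shift d)) :=
  gen_subgroup (@H_alt_tail d @` [set` H]).

Lemma tail_groupP k : k \in tail_group <-> (@H_alt_tail d @` [set` H]) k.
Proof. exact: gen_subgroup_image. Qed.

Lemma rooted_alt_directed a :
  a \in 'Alt_('I_(d 0)) -> rooted a \in alt_directed_group H.
Proof. by move=> aA; apply: mem_gen_subgroup; left; exists a. Qed.

Lemma directed_alt_directed h : h \in H -> directed h \in alt_directed_group H.
Proof. by move=> hH; apply: mem_gen_subgroup; right; exists h. Qed.

End Sections.

(** The easy inclusion: the decomposition lands in the wreath product. The product and quotient
    formulas reduce it to generators, whose sections are trivial, rooted, or directed by a tail. *)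
Lemma alt_directed_section d (H : groupClosed (H_alt d)) x :
    x \in alt_directed_group H ->
  first_perm x \in ('Alt_('I_(d 0)))%g /\
  (forall t, tree_section x t \in alt_directed_group (tail_group H)).
Proof.
move: x; apply: gen_subgroup_ind => [|x y [xA xS] [yA yS]|_ [[a aA <-]|[h hH <-]]].
- split; first by rewrite (morph_one (@first_permM d)) group1.
  move=> t; have -> : tree_section (1 : tree_aut d)%g t = 1%g by apply: tree_autP.
  exact: gpred1.
- split; first by rewrite (morph_div (@first_permM d)) groupM ?groupV.
  by move=> t; rewrite tree_sectionF gpredF.
- rewrite first_perm_rooted; split=> // t.
  by rewrite tree_section_rooted gpred1.
- rewrite first_perm_directed; split.
    by have := subgP (wtop (h 0)); rewrite inE => /andP[].
  move=> t; rewrite tree_section_directed; case: insub => [u|].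
    by apply: rooted_alt_directed; apply: subgP.
  by apply: directed_alt_directed; apply/tail_groupP; exists h.
Qed.

(** * The data carried along the shift *)

(** The fields are properties inherited by the shift, so that the construction can be iterated.
    Saturation enters through [dir_full]. *)
Record directed_data := DirectedData {
  deg :> nat -> nat;
  deg_ge5 : forall i, 5 <= deg i;
  dir_group : groupClosed (H_alt deg);
  dir_finite : finite_set [set` dir_group];
  dir_full : forall i (x : AT (deg i) (deg i.+1)),
    exists2 h, h \in dir_group & h i = x
}.

Section Shift.
Variable D : directed_data.

Lemma tail_group_finite : finite_set [set` tail_group (dir_group D)].
Proof.
suff -> : [set` tail_group (dir_group D)] = @H_alt_tail D @` [set` dir_group D].
  exact/finite_image/dir_finite.
by apply/seteqP; split=> k; rewrite /= ?tail_groupP.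
Qed.

Lemma tail_group_full i (x : AT (shift D i) (shift D i.+1)) :
  exists2 k, k \in tail_group (dir_group D) & k i = x.
Proof.
have [h hH hx] := @dir_full D i.+1 x.
by exists (H_alt_tail h) => //; apply/tail_groupP; exists h.
Qed.

Definition shift_data : directed_data :=
  @DirectedData (shift D) (fun i => deg_ge5 D i.+1) (tail_group (dir_group D))
    tail_group_finite tail_group_full.

End Shift.

Definition dir_type (D : directed_data) : groupType :=
  subgroup_type (alt_directed_group (dir_group D)).

(** * The subgroups [A_i] and [H_i] of property DP *)

Section Parts.
Local Open Scope group_scope.
Variable D : directed_data.

Definition rooted_part : groupClosed (dir_type D) :=
  gen_subgroup [set g : dir_type D |
    (@rooted D @` [set` 'Alt_('I_(D 0))]) (val g)].

Definition directed_part : groupClosed (dir_type D) :=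
  gen_subgroup [set g : dir_type D | (@directed D @` [set` dir_group D]) (val g)].

Lemma rooted_partP g : g \in rooted_part <->
  (@rooted D @` [set` 'Alt_('I_(D 0))]) (val g).
Proof.
apply: gen_subgroup_id => [|x y [a aA ax] [b bA bY]].
  exists 1; first exact: group1.
  by rewrite val1 (morph_one (@rootedM D)).
exists (a * b^-1); first by apply: groupM; rewrite ?groupV.
by rewrite (morph_div (@rootedM D)) ax bY.
Qed.

Lemma directed_partP g : g \in directed_part <->
  (@directed D @` [set` dir_group D]) (val g).
Proof.
apply: gen_subgroup_id => [|x y [a aA ax] [b bA bY]].
  exists 1; first exact: gpred1.
  by rewrite val1 (morph_one (@directedM D)).
exists (a * b^-1); first exact: gpredF.
by rewrite (morph_div (@directedM D)) ax bY.
Qed.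

Lemma rooted_part_finite : finite_set [set` rooted_part].
Proof.
have -> : [set` rooted_part] =
    val @^-1` (@rooted D @` [set` 'Alt_('I_(D 0))]).
  by apply/seteqP; split=> g; rewrite /= rooted_partP.
apply: finite_preimage; first by move=> ? ? _ _; apply: val_inj.
exact/finite_image/finite_finset.
Qed.

(** The subgroup is finite, so it serves as its own generating set. *)
Lemma directed_part_fin_generated : fin_generated directed_part.
Proof.
exists [set` directed_part]; last exact: gen_subgroup_self.
have -> : [set` directed_part] = val @^-1` (@directed D @` [set` dir_group D]).
  by apply/seteqP; split=> g; rewrite /= directed_partP.
apply: finite_preimage; first by move=> ? ? _ _; apply: val_inj.
exact/finite_image/dir_finite.
Qed.

Lemma parts_generate :
  gen_subgroup ([set` rooted_part] `|` [set` directed_part]) =i predT.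
Proof.
(* The known generation takes place among tree automorphisms, the wanted one in the subgroup type;
   the induction therefore builds a lift along with its membership. *)
suff gen x : x \in alt_directed_group (dir_group D) ->
    exists2 y : dir_type D, val y = x &
      y \in gen_subgroup ([set` rooted_part] `|` [set` directed_part]).
  by move=> g; have [y /val_inj <- ->] := gen _ (valP g).
move: x; apply: gen_subgroup_ind.
- by exists 1; [rewrite val1 | exact: gpred1].
- move=> _ _ [x <- xG] [y <- yG].
  by exists (x * y^-1); [rewrite (morph_div (@valM _ _ (dir_type D))) | exact: gpredF].
- move=> _ [[a aA <-]|[h hH <-]].
    exists (Sub (rooted a) (rooted_alt_directed _ aA)) => //.
    by apply: mem_gen_subgroup; left; apply/rooted_partP; exists a.
  exists (Sub (directed h) (directed_alt_directed hH)) => //.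
  by apply: mem_gen_subgroup; right; apply/directed_partP; exists h.
Qed.

End Parts.

(** * The isomorphism with the wreath product over the shifted group *)

Section Decomposition.
Local Open Scope group_scope.
Variable D : directed_data.

Definition first_action_fun t (a : subgroup_type (rooted_part D)) :=
  first_letter t (val (val a)).

Lemma first_action1 t : first_action_fun t 1 = t.
Proof. by []. Qed.

Lemma first_actionM t a b : first_action_fun t (a * b) =
  first_action_fun (first_action_fun t a) b.
Proof. by rewrite /first_action_fun !valM first_letterM. Qed.

Definition first_action : gaction (subgroup_type (rooted_part D)) 'I_(D 0) :=
  GAction first_action1 first_actionM.

Definition rooted_elt (a : {perm 'I_(D 0)}) : subgroup_type (rooted_part D) :=
  insubd 1 (insubd 1 (rooted a) : dir_type D).

Lemma val_rooted_elt a : a \in 'Alt_('I_(D 0)) -> val (val (rooted_elt a)) = rooted a.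
Proof.
move=> aA; have e : val (insubd 1 (rooted a) : dir_type D) = rooted a.
  by rewrite insubdK // rooted_alt_directed.
by rewrite /rooted_elt insubdK // rooted_partP e; exists a.
Qed.

Lemma first_action_rooted t a :
  a \in 'Alt_('I_(D 0)) -> first_action t (rooted_elt a) = a t.
Proof. by move=> aA; rewrite /= /first_action_fun val_rooted_elt. Qed.

(** The default 1 of [insubd], here and in [rooted_elt], is never reached: by [alt_directed_section]
    the sections lie in the shifted group and the first-level permutation is even. *)
Definition decomp (g : dir_type D) :
    wreath (dir_type (shift_data D)) first_action :=
  Wreath first_action [ffun t => insubd 1 (tree_section (val g) t)]
    (rooted_elt (first_perm (val g))).

Lemma val_decomp_base g t : val (wbase (decomp g) t) = tree_section (val g) t.
Proof.
rewrite ffunE insubdK //.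
by have [_] := alt_directed_section (valP g); apply.
Qed.

Lemma val_decomp_top g :
  val (val (wtop (decomp g))) = rooted (first_perm (val g)).
Proof.
rewrite val_rooted_elt //.
by have [] := alt_directed_section (valP g).
Qed.

Lemma decomp_act g t : first_action t (wtop (decomp g)) = first_letter t (val g).
Proof. by rewrite /= /first_action_fun val_decomp_top -[LHS]first_permE first_perm_rooted first_permE. Qed.

Lemma decompM : {morph decomp : x y / x * y}.
Proof.
move=> x y; apply: wreath_eq => [t|].
  apply: val_inj; rewrite wbaseM !valM !val_decomp_base decomp_act.
  by rewrite valM tree_sectionM.
apply/val_inj/val_inj.
by rewrite wtopM !valM !val_decomp_top !valM first_permM rootedM.
Qed.

HB.instance Definition _ := isMultiplicative.Build _ _ decomp decompM.

Lemma decomp_inj : injective decomp.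
Proof.
move=> x y xy; apply: val_inj; apply: tree_section_eq => t.
  by rewrite -!decomp_act xy.
by rewrite -!val_decomp_base xy.
Qed.

Lemma decomp_rooted (s : subgroup_type (rooted_part D)) :
  decomp (val s) = Wreath first_action [ffun=> 1] s.
Proof.
have /rooted_partP[a aA as_] := valP s.
apply: wreath_eq => [t|]; apply: val_inj.
  by rewrite val_decomp_base ffunE -as_ tree_section_rooted.
by apply: val_inj; rewrite val_decomp_top -as_ first_perm_rooted.
Qed.

Let letter0 : 'I_(D 0) := 
  Ordinal (leq_trans (isT : (0 < 5)%N) (deg_ge5 D 0)).

Lemma Alt_ltn_card i : 4 < #|'I_(D i)|.
Proof. by rewrite card_ord; apply: deg_ge5. Qed.

(** The image of [decomp], packaged as a subgroup so that the generation lemmas for wreath products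
    apply to it. *)
Let S : groupClosed (wreath (dir_type (shift_data D)) first_action) :=
  gen_subgroup (range decomp).

Lemma decomp_imageP w : w \in S <-> range decomp w.
Proof.
apply: gen_subgroup_id => [|_ _ [x _ <-] [y _ <-]].
  by exists 1 => //; exact: morph_one decompM.
by exists (x * y^-1) => //; exact: morph_div decompM _ _.
Qed.

Lemma decomp_in g : decomp g \in S.
Proof. by apply/decomp_imageP; exists g. Qed.

Lemma wrooted_decomp a : wrooted _ first_action a \in S.
Proof. by rewrite /wrooted -decomp_rooted decomp_in. Qed.

Lemma first_action_transitive t u : exists a, first_action t a = u.
Proof.
have [s sA <-] := Alt_moves t u (Alt_ltn_card 0).
by exists (rooted_elt s); rewrite first_action_rooted.
Qed.

Lemma val_decomp_directed g h t : val g = directed h ->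
  val (wbase (decomp g) t) =
  if insub t is Some u then rooted (d := shift D) (sgval (wbase (h 0) u))
  else directed (H_alt_tail h).
Proof. by move=> gh; rewrite val_decomp_base gh tree_section_directed. Qed.

Definition rooted_shift (b : {perm 'I_(D 1%N)}) : dir_type (shift_data D) :=
  insubd 1 (rooted (d := shift D) b).

Lemma val_rooted_shift b :
  b \in 'Alt_('I_(D 1%N)) -> val (rooted_shift b) = rooted (d := shift D) b.
Proof. by move=> bA; rewrite insubdK //; apply: rooted_alt_directed. Qed.

Lemma rooted_shiftM : {in 'Alt_('I_(D 1%N)) &, {morph rooted_shift : a b / a * b}}.
Proof.
move=> a b aA bA; apply: val_inj.
by rewrite valM !val_rooted_shift ?groupM // rootedM.
Qed.

Lemma rooted_shift1 : rooted_shift 1 = 1.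
Proof.
by apply: val_inj; rewrite val_rooted_shift // (morph_one (@rootedM (shift D))).
Qed.

(** Surjectivity of the coordinate map at level 0 gives an [h] whose component there is [b] placed
    at [u] with trivial top. The coordinate at [letter0], the tail of [h], stays uncontrolled. *)
Lemma decomp_coordinate b (u : 'I_(D 0)) : b \in 'Alt_('I_(D 1%N)) ->
    u != letter0 ->
  exists2 w, w \in S & [/\ wtop w = 1, wbase w u = rooted_shift b &
    forall t, t != letter0 -> t != u -> wbase w t = 1].
Proof.
move=> bA u0; pose x : AT (D 0) (D 1%N) := Wreath (alt_stab_action (D 0))
  [ffun v => if val v == u then subg 'Alt_('I_(D 1%N)) b else 1] 1.
have [h hH hx] := dir_full x.
pose g : dir_type D := Sub (directed h) (directed_alt_directed hH).
have gh : val g = directed h by [].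
exists (decomp g); first exact: decomp_in.
have base t : t != letter0 ->
    wbase (decomp g) t = if t == u then rooted_shift b else 1.
  move=> t0; apply: val_inj; rewrite (val_decomp_directed _ gh) (insub_tail t0) hx.
  rewrite ffunE /=; case: eqP => _; first by rewrite val_rooted_shift // subgK.
  exact: (morph_one (@rootedM (shift D))).
split=> [||t t0 /negPf tu]; rewrite ?base ?eqxx ?tu //.
apply/val_inj/val_inj; rewrite val_decomp_top gh first_perm_directed hx.
exact: (morph_one (@rootedM D)).
Qed.

(** Commutators get rid of the uncontrolled tails at [letter0], and perfectness makes commutators
    sufficient. *)
Lemma wsingle_rooted_shift b t :
  b \in 'Alt_('I_(D 1%N)) -> wsingle first_action t (rooted_shift b) \in S.
Proof.
(* Any letter other than [letter0] would do; transitivity carries the result from [u] to every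
   [t]. *)
pose u : 'I_(D 0) := 
  Ordinal (leq_trans (isT : (1 < 5)%N) (deg_ge5 D 0)).
move: b; suff sub b : b \in 'Alt_('I_(D 1%N)) ->
    wsingle first_action u (rooted_shift b) \in S.
  move=> b bA; apply: wsingle_transport (first_action_transitive u t) (sub b bA).
  exact: wrooted_decomp.
(* The permutations that can be realized alone at [u] form a group, so it is enough that this group
   contains all commutators. *)
pose K := [set b in 'Alt_('I_(D 1%N)) |
  wsingle first_action u (rooted_shift b) \in S]%SET.
have KP a : (a \in K) = (a \in 'Alt_('I_(D 1%N))) &&
    (wsingle first_action u (rooted_shift a) \in S) by rewrite finset.in_set.
have K_group : group_set K.
  apply/group_setP; split=> [|a c].
    rewrite KP group1 rooted_shift1 (morph_one (@wsingleM _ _ _ _ u)).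
    exact: gpred1.
  rewrite !KP => /andP[aA aS] /andP[cA cS].
  by rewrite groupM // rooted_shiftM // wsingleM gpredM.
suff : 'Alt_('I_(D 1%N)) \subset Group K_group.
  by move=> /fintype.subsetP/[apply]; rewrite KP => /andP[].
rewrite -{1}(Alt_perfect (Alt_ltn_card 1%N)) gen_subG; apply/fintype.subsetP.
move=> _ /imset2P[a c aA cA ->]; rewrite KP groupR //=.
have u0 : u != letter0 by [].
have [w1 w1S [w11 w1u w1t]] := decomp_coordinate aA u0.
have [w2 w2S [w21 w2u w2t]] := decomp_coordinate cA u0.
have [|s sA [su s0]] := @Alt_displaces _ letter0 u (Alt_ltn_card 0).
  by rewrite eq_sym.
have -> : rooted_shift [~ a, c] = [~ wbase w1 u, wbase w2 u].
  rewrite w1u w2u; apply: val_inj.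
  rewrite (morph_commg (@valM _ _ (dir_type (shift_data D)))) !val_rooted_shift //.
    exact: (morph_commg (@rootedM (shift D))).
  exact: groupR.
apply: (@wsingle_commutator _ _ _ _ _ wrooted_decomp _ _ letter0 _ (rooted_elt s)) => //.
- by rewrite first_action_rooted.
- by rewrite first_action_rooted.
Qed.

(** It suffices to place each generator of the shifted group alone at each letter. Rooted generators
    are done; a directed one is the [letter0] coordinate of some [decomp x] whose other coordinates
    are rooted and can be stripped off. *)
Lemma decomp_full w : w \in S.
Proof.
suff sub (g : dir_type (shift_data D)) : g \in gen_subgroup
    ([set` rooted_part (shift_data D)] `|` [set` directed_part (shift_data D)]) ->
    forall t, wsingle first_action t g \in S.
  rewrite (wreath_full wrooted_decomp) // => t g.
  by apply: sub; rewrite parts_generate.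
move: g; apply: gen_subgroup_ind => [t|x y xS yS t|].
- by rewrite (morph_one (wsingleM _ t)) gpred1.
- by rewrite (morph_div (wsingleM _ t)) gpredF.
move=> g [/= /rooted_partP[b bA bg]|/= /directed_partP[k /tail_groupP[h hH hk] kg]] t.
  suff -> : g = rooted_shift b by apply: wsingle_rooted_shift.
  by apply: val_inj; rewrite val_rooted_shift.
pose x : dir_type D := Sub (directed h) (directed_alt_directed hH).
have xh : val x = directed h by [].
have -> : g = wbase (decomp x) letter0.
  by apply: val_inj; rewrite (val_decomp_directed _ xh) insubF // hk.
apply: wsingle_transport (first_action_transitive letter0 t) _ => //.
  exact: wrooted_decomp.
apply: (wsingle_strip wrooted_decomp (decomp_in x)) => u u0.
suff -> : wbase (decomp x) u = rooted_shift (sgval (wbase (h 0) (Sub u u0))).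
  exact/wsingle_rooted_shift/subgP.
apply: val_inj; rewrite (val_decomp_directed _ xh) (insub_tail u0).
by rewrite val_rooted_shift //; apply: subgP.
Qed.

Lemma decomp_bijective : bijective decomp.
Proof.
rewrite -setTT_bijective; split=> // [x y _ _ /decomp_inj//|w _].
exact/decomp_imageP/decomp_full.
Qed.

Lemma decomp_directed h : h \in (directed_part D) ->
  [/\ forall t : 'I_(D 0), val t = 0%N ->
        wbase (decomp h) t \in directed_part (shift_data D),
      forall t : 'I_(D 0), val t <> 0%N ->
        wbase (decomp h) t \in rooted_part (shift_data D)
    & forall t : 'I_(D 0), val t = 0%N ->
        first_action t (wtop (decomp h)) = t].
Proof.
move=> /directed_partP[k kH /esym hk]; split=> t t0.
- apply/directed_partP; rewrite (val_decomp_directed _ hk) insubF ?t0 //.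
  by exists (H_alt_tail k) => //; apply/tail_groupP; exists k.
- move/eqP in t0; apply/rooted_partP.
  rewrite (val_decomp_directed _ hk) (insub_tail t0).
  by exists (sgval (wbase (k 0) (Sub t t0))); first exact: subgP.
- rewrite decomp_act hk -first_permE first_perm_directed.
  exact: alt_stab_fix.
Qed.

End Decomposition.

(** * Iterating the decomposition *)

Section Iteration.
Variable D : directed_data.

Let data_at i := iter i shift_data D.

Lemma dir_type_DP : has_DP (dir_type D).
Proof.
exists (fun i => dir_type (data_at i)); last first.
  by exists (idfun : {multiplicative dir_type D -> dir_type D}); exists id.
exists (fun i => data_at i 0%N), (fun i => rooted_part (data_at i)),
  (fun i => directed_part (data_at i)), (fun i => first_action (data_at i)) => i.
split.
- exact: parts_generate.
- exact: rooted_part_finite.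
- split; last exact: first_action_transitive.
  exact: leq_trans (deg_ge5 (data_at i) 0%N).
- exact: directed_part_fin_generated.
(* The types agree because [data_at i.+1] unfolds to [shift_data (data_at i)]. *)
- exists (@decomp (data_at i)); split.
  + exact: decomp_bijective.
  + exact: decomp_rooted.
  + exact: decomp_directed.
Qed.

End Iteration.

(** * From saturation to surjective coordinate maps *)

Section Saturation.
Local Open Scope group_scope.
Variables (d : nat -> nat) (B : set (H_alt d)).

Lemma AT_values_proj_surj (s : AT_values B) x :
  exists y : AT_values_prod B, y s = x.
Proof.
(* This is [x] at [s] and 1 elsewhere; the factor depends on the index, so [x] is transported along
   the equality of indices. *)
exists (fun s' => if pselect (s = s') is left e
  then eq_rect s (fun z => AT (tag (sval z)).1 (tag (sval z)).2) x s' e else 1).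
by case: pselect => // e; rewrite (Prop_irrelevance e erefl).
Qed.

Lemma saturating_full i (x : AT (d i) (d i.+1)) : saturating B ->
  exists2 h, h \in gen_subgroup B & h i = x.
Proof.
move=> satB; pose s : AT_values B :=
  exist _ (AT_family_at B i) (ex_intro2 _ _ i I erefl).
have [y yx] := AT_values_proj_surj (s := s) x.
have : y \in gen_subgroup (range (@AT_values_elt d B)) by rewrite satB.
(* For the value [s] taken at level [i], the coordinate at [s] of a generating tuple is the [i]-th
   component of the corresponding [b]; induction extends this match to the generated subgroups. *)
suff proj z : z \in gen_subgroup (range (@AT_values_elt d B)) ->
    exists2 h, h \in gen_subgroup B & h i = z s.
  by move/proj; rewrite yx.
move: z; apply: gen_subgroup_ind => [|z1 z2 [h1 h1B e1] [h2 h2B e2]|_ [b _ <-]].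
- by exists 1; first exact: gpred1.
- by exists (h1 * h2^-1); [exact: gpredF | rewrite -[RHS]/(z1 s * (z2 s)^-1) -e1 -e2].
- by exists (sval b); first exact/mem_gen_subgroup/svalP.
Qed.

End Saturation.

Theorem proposition5p3 (d : nat -> nat)
    (d_bounded : exists M : nat, forall i, (d i <= M)%N)
    (d_ge5 : forall i, (5 <= d i)%N)
    (H : groupClosed (H_alt d))
    (H_finite : finite_set [set` H])
    (H_saturated : saturated H) :
  has_DP (subgroup_type (alt_directed_group H)).
Proof.
have H_full i (x : AT (d i) (d i.+1)) : exists2 h, h \in H & h i = x.
  have [B [_ HB satB]] := H_saturated.
  by have [h hB hx] := saturating_full x satB; exists h => //; rewrite HB.
exact: (dir_type_DP (DirectedData d_ge5 H_finite H_full)).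
Qed.
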